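(* Let $k\geq2$ be an integer. The decision problem ''Given a $k$-regular sequence $(f(n))_{n\geq0}$, does $(f(n))_{n\geq0}$ contain a nontrivial palindrome?'' is recursively unsolvable.
   Context: For $n\in\mathbb{N}_0$, $(n)_k=n_{s-1}\cdots n_0$ is the standard base-$k$ representation of $n$ (no leading zeros; $(0)_k$ empty). A sequence $(f(n))_{n\geq0}$ is $k$-regular if there exist $r\geq0$, a $1\times r$ row vector $v$, an $r\times1$ column vector $w$ and $r\times r$ matrices $M_0,\dots,M_{k-1}$ such that $f(n)=vM_{n_0}\cdots M_{n_{s-1}}w$ for all $n$; the input is such a linear representation. A palindrome in $(f(n))$ is a nonempty contiguous block $(f(j))_{i\leq j<i+L}$ that reads the same forwards and backwards, i.e., $f(i+t)=f(i+L-1-t)$ for $0\leq t<L$; it is nontrivial if $L\geq2$. *)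

(* Defs.v *)
From mathcomp Require Import all_boot all_order all_algebra.
Set Implicit Arguments. Unset Strict Implicit. Unset Printing Implicit Defensive.
Import GRing.Theory Num.Theory.

(* Functions take an argument list (seq nat); arities are untyped, missing  *)
(* arguments default to 0 (this does not change the computable class).      *)
Inductive prf : Type :=
| PZero : prf
| PSucc : prf
| PProj : nat -> prf
| PComp : prf -> list prf -> prf
| PPrim : prf -> prf -> prf
| PMu   : prf -> prf.

Inductive eval : prf -> seq nat -> nat -> Prop :=
| ev_zero xs : eval PZero xs 0
| ev_succ xs : eval PSucc xs (head 0 xs).+1
| ev_proj i xs : eval (PProj i) xs (nth 0 xs i)
| ev_comp f gs xs ys y :
    eval_list gs xs ys -> eval f ys y -> eval (PComp f gs) xs y
| ev_prim0 f g xs y : eval f xs y -> eval (PPrim f g) (0 :: xs) y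
| ev_primS f g x xs z y :
    eval (PPrim f g) (x :: xs) z -> eval g (x :: z :: xs) y ->
    eval (PPrim f g) (x.+1 :: xs) y
| ev_mu f xs y :
    eval f (y :: xs) 0 ->
    (forall z, z < y -> exists2 v, eval f (z :: xs) v & v <> 0) ->
    eval (PMu f) xs y
with eval_list : list prf -> seq nat -> seq nat -> Prop :=
| evl_nil xs : eval_list nil xs [::]
| evl_cons g gs xs y ys :
    eval g xs y -> eval_list gs xs ys -> eval_list (g :: gs) xs (y :: ys).

Definition decidable_set (A : nat -> Prop) : Prop :=
  exists p : prf, forall n : nat,
    (A n -> eval p [:: n] 1) /\ (~ A n -> eval p [:: n] 0).

Fixpoint digits_aux (k fuel n : nat) : seq nat :=
  if fuel is fuel'.+1 then
    if n == 0 then [::] else (n %% k) :: digits_aux k fuel' (n %/ k)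
  else [::].
Definition digits (k n : nat) : seq nat := digits_aux k n n.

Definition linrep (k : nat) : Type :=
  {r : nat & ('rV[int]_r * 'cV[int]_r * k.-tuple 'M[int]_r)%type}.

Local Open Scope ring_scope.
Definition kreg_seq (k : nat) (L : linrep k) (n : nat) : int :=
  let: existT r (v, w, Ms) := L in
  (v *m foldr (fun d (acc : 'cV[int]_r) => nth 0%R Ms d *m acc) w (digits k n))
    ord0 ord0.

Local Close Scope ring_scope.
Definition has_nontrivial_palindrome (f : nat -> int) : Prop :=
  exists i len : nat, 2 <= len /\
    forall t, t < len -> f (i + t) = f (i + len - 1 - t).

Definition palindrome_problem (k : nat) (c : nat) : Prop :=
  exists L : linrep k, pickle L = c /\ has_nontrivial_palindrome (kreg_seq L).

(* Main.v *)
(* The problem is undecidable by self-application. For every program [q], a family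
   [L_n] of linear representations is built, in which only two entries of the
   initial vector depend on [n] (they are [n] and [n * n]), such that [L_n] has a
   nontrivial palindrome iff [q] halts on [n]. A code of [L_a] can be turned into
   the code of [L_c] by a recursive function that touches nothing but these two
   entries; so if [p] decided the problem, one could take for [q]
   the program that on input [c] halts iff [p] rejects the representation obtained
   by substituting [c] in the representation coded by [c], and run it on a code of
   its own family.

   To build [L_n], [q] is compiled to a nondeterministic program on integer
   registers with affine assignments, equality checks and loops. The base-k digits
   of a number resolve the nondeterministic choices. The vector attached to a
   number holds, in the block of the current program counter, the products
   [z i * z j] of the registers and the accumulated sum of the squared defects of
   the checks; these are updated linearly. So some linear form [h] vanishes at some
   number iff [q] halts. Finally [f (k m + 1) = k m + 4 h m] and [f i = i] at the
   other indices: modulo 4, a palindrome forces [f (k m) = f (k m + 1)]. *)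
Require Import Defs.
From mathcomp Require Import all_boot all_order all_algebra.
From mathcomp Require Import zify ring.
Set Implicit Arguments. Unset Strict Implicit. Unset Printing Implicit Defensive.
Import Order.TTheory GRing.Theory Num.Theory.

(** * Recursive functions and codes *)

Section PrfInd.
Variable P : prf -> Prop.
Hypothesis HZ : P PZero.
Hypothesis HS : P PSucc.
Hypothesis HP : forall i, P (PProj i).
Hypothesis HC : forall f gs, P f -> foldr (fun g Q => P g /\ Q) True gs -> P (PComp f gs).
Hypothesis HR : forall f g, P f -> P g -> P (PPrim f g).
Hypothesis HM : forall f, P f -> P (PMu f).

(** The generated induction principle has no hypothesis on the inner functions of [PComp], which
    form a nested list; here it is supplied. *)
Fixpoint prf_nested_ind (p : prf) : P p :=
  match p with
  | PZero => HZ
  | PSucc => HS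
  | PProj i => HP i
  | PComp f gs => HC (prf_nested_ind f)
      ((fix go gs : foldr (fun g Q => P g /\ Q) True gs :=
          match gs with
          | [::] => I
          | g :: gs' => conj (prf_nested_ind g) (go gs')
          end) gs)
  | PPrim f g => HR (prf_nested_ind f) (prf_nested_ind g)
  | PMu f => HM (prf_nested_ind f)
  end.
End PrfInd.

Lemma eval_det p xs y y' : eval p xs y -> eval p xs y' -> y = y'.
Proof.
elim/prf_nested_ind: p xs y y' => [||i|f gs IHf IHgs|f g IHf IHg|f IHf] xs y y' H1 H2.
- by inversion H1; inversion H2.
- by inversion H1; inversion H2.
- by inversion H1; inversion H2.
- inversion H1 as [| | |? ? ? ys ? e1 f1| | |]; subst.
  inversion H2 as [| | |? ? ? ys' ? e2 f2| | |]; subst.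
  suff eys : ys = ys' by apply: IHf f1 _; rewrite eys.
  elim: gs IHgs ys ys' e1 e2 {H1 H2 f1 f2} => [|g gs IH] /= IHgs ys ys' e1 e2.
    by inversion e1; inversion e2.
  case: IHgs => IHg IHgs.
  inversion e1 as [|? ? ? z zs g1 l1]; subst.
  inversion e2 as [|? ? ? z' zs' g2 l2]; subst.
  by rewrite (IHg _ _ _ g1 g2) (IH IHgs _ _ l1 l2).
- case: xs H1 H2 => [|x xs] H1 H2.
    by inversion H1.
  elim: x y y' H1 H2 => [|x IH] y y' H1 H2.
    inversion H1 as [| | | |? ? ? ? f1| |]; subst.
    inversion H2 as [| | | |? ? ? ? f2| |]; subst.
    exact: IHf f1 f2.
  inversion H1 as [| | | | |? ? ? ? z ? r1 s1|]; subst.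
  inversion H2 as [| | | | |? ? ? ? z' ? r2 s2|]; subst.
  by rewrite (IH _ _ r1 r2) in s1; apply: IHg s1 s2.
- inversion H1 as [| | | | | |? ? ? z1 m1]; subst.
  inversion H2 as [| | | | | |? ? ? z2 m2]; subst.
  case: (ltngtP y y') => // lt.
    by case: (m2 _ lt) => v ev []; apply: IHf ev z1.
  by case: (m1 _ lt) => v ev []; apply: IHf ev z2.
Qed.

Lemma eval_comp1 f g xs y z :
  eval g xs y -> eval f [:: y] z -> eval (PComp f [:: g]) xs z.
Proof. by move=> Hg; apply: ev_comp; do !constructor. Qed.

Lemma eval_comp2 f g1 g2 xs y1 y2 z :
  eval g1 xs y1 -> eval g2 xs y2 -> eval f [:: y1; y2] z ->
  eval (PComp f [:: g1; g2]) xs z.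
Proof. by move=> H1 H2; apply: ev_comp; do !constructor. Qed.

Definition prf_nat (n : nat) : prf := iter n (fun q => PComp PSucc [:: q]) PZero.

Lemma eval_nat n xs : eval (prf_nat n) xs n.
Proof.
elim: n => [|n IH] /=; first exact: ev_zero.
by apply: eval_comp1 IH _; apply: (ev_succ [:: n]).
Qed.

Definition prf_add : prf := PPrim (PProj 0) (PComp PSucc [:: PProj 1]).

Lemma eval_add x y : eval prf_add [:: x; y] (x + y).
Proof.
elim: x => [|x IH]; first by apply: ev_prim0; apply: (ev_proj 0 [:: y]).
apply: ev_primS IH _; apply: eval_comp1 (ev_proj 1 _) _.
exact: (ev_succ [:: x + y]).
Qed.

Definition prf_mul : prf := PPrim PZero (PComp prf_add [:: PProj 2; PProj 1]).

Lemma eval_mul x y : eval prf_mul [:: x; y] (x * y).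
Proof.
elim: x => [|x IH]; first by apply: ev_prim0; apply: ev_zero.
apply: ev_primS IH _; rewrite mulSn.
exact: eval_comp2 (ev_proj 2 _) (ev_proj 1 _) (eval_add _ _).
Qed.

Definition prf_not : prf := PPrim (prf_nat 1) PZero.

Lemma eval_not (b : bool) : eval prf_not [:: b : nat] (~~ b).
Proof.
case: b; last by apply: ev_prim0; apply: eval_nat.
by apply: (@ev_primS _ _ 0 [::] 1); [apply: ev_prim0; apply: eval_nat | apply: ev_zero].
Qed.

Definition prf_odd : prf := PPrim PZero (PComp prf_not [:: PProj 1]).

Lemma eval_odd n : eval prf_odd [:: n] (odd n).
Proof.
elim: n => [|n IH]; first by apply: ev_prim0; apply: ev_zero.
apply: ev_primS IH _; apply: eval_comp1 (ev_proj 1 _) _.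
exact: eval_not.
Qed.

Definition prf_half : prf :=
  PPrim PZero (PComp prf_add [:: PComp prf_odd [:: PProj 0]; PProj 1]).

Lemma eval_half n : eval prf_half [:: n] n./2.
Proof.
elim: n => [|n IH]; first by apply: ev_prim0; apply: ev_zero.
apply: ev_primS IH _; rewrite /= uphalf_half.
apply: (eval_comp2 _ (ev_proj 1 _) (eval_add _ _)).
exact: eval_comp1 (ev_proj 0 _) (eval_odd _).
Qed.

Definition prf_halves : prf := PPrim (PProj 0) (PComp prf_half [:: PProj 1]).

Lemma eval_halves n m : eval prf_halves [:: n; m] (iter n half m).
Proof.
elim: n => [|n IH]; first by apply: ev_prim0; apply: (ev_proj 0 [:: m]).
by apply: ev_primS IH _; apply: eval_comp1 (ev_proj 1 _) (eval_half _).
Qed.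

(** The code of [x :: s] is [2 ^ x] times the odd number [(CodeSeq.code s).*2.+1], so the head
    counts the halvings until an odd number appears. *)
Definition prf_hd : prf := PMu (PComp prf_not [:: PComp prf_odd [:: prf_halves]]).
Definition prf_tl : prf :=
  PComp prf_half [:: PComp prf_halves [:: prf_hd; PProj 0]].
Definition prf_cons : prf :=
  PPrim (PComp PSucc [:: PComp prf_add [:: PProj 0; PProj 0]])
        (PComp prf_add [:: PProj 1; PProj 1]).

Lemma iter_half_code n x s :
  n <= x -> iter n half (CodeSeq.code (x :: s)) = 2 ^ (x - n) * (CodeSeq.code s).*2.+1.
Proof.
elim: n => [|n IH] lt; first by rewrite subn0.
rewrite iterS IH ?(ltnW lt) // -(subnSK lt) expnS -mulnA mul2n doubleK.
by [].
Qed.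

Lemma eval_hd x s : eval prf_hd [:: CodeSeq.code (x :: s)] x.
Proof.
have H z : z <= x -> eval (PComp prf_not [:: PComp prf_odd [:: prf_halves]])
    [:: z; CodeSeq.code (x :: s)] (z < x).
  move=> le; apply: eval_comp1.
    by apply: eval_comp1 (eval_odd _); apply: eval_halves.
  suff -> : (z < x) = ~~ odd (iter z half (CodeSeq.code (x :: s))) by apply: eval_not.
  by rewrite iter_half_code // oddM oddX /= odd_double andbT orbF subn_eq0 -ltnNge.
apply: ev_mu; first by have := H x (leqnn x); rewrite ltnn.
by move=> z lt; exists 1 => //; have := H z (ltnW lt); rewrite lt.
Qed.

Lemma eval_tl x s : eval prf_tl [:: CodeSeq.code (x :: s)] (CodeSeq.code s).
Proof.
apply: eval_comp1; first by apply: eval_comp2 (eval_hd _ _) (ev_proj 0 _) (eval_halves _ _).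
rewrite /= iter_half_code // subnn mul1n.
by have := eval_half (CodeSeq.code s).*2.+1; rewrite /= uphalf_double.
Qed.

Lemma eval_cons x s : eval prf_cons [:: x; CodeSeq.code s] (CodeSeq.code (x :: s)).
Proof.
rewrite [CodeSeq.code (x :: s)]/=; move: (CodeSeq.code s) => m.
elim: x => [|x IH].
  apply: ev_prim0; rewrite mul1n -addnn; apply: (eval_comp1 _ (ev_succ [:: m + m])).
  exact: eval_comp2 (ev_proj 0 _) (ev_proj 0 _) (eval_add _ _).
apply: ev_primS IH _; rewrite expnS -mulnA mul2n -(addnn (2 ^ x * _)).
exact: eval_comp2 (ev_proj 1 _) (ev_proj 1 _) (eval_add _ _).
Qed.

Lemma eval_hd_of p xs x s :
  eval p xs (CodeSeq.code (x :: s)) -> eval (PComp prf_hd [:: p]) xs x.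
Proof. by move=> H; apply: eval_comp1 H (eval_hd _ _). Qed.

Lemma eval_tl_of p xs x s :
  eval p xs (CodeSeq.code (x :: s)) -> eval (PComp prf_tl [:: p]) xs (CodeSeq.code s).
Proof. by move=> H; apply: eval_comp1 H (eval_tl _ _). Qed.

Fixpoint prf_list (ps : seq prf) (p : prf) : prf :=
  if ps is q :: ps' then PComp prf_cons [:: q; prf_list ps' p] else p.

Lemma eval_cons_of p q xs x s :
  eval p xs x -> eval q xs (CodeSeq.code s) ->
  eval (PComp prf_cons [:: p; q]) xs (CodeSeq.code (x :: s)).
Proof. by move=> H1 H2; apply: eval_comp2 H1 H2 (eval_cons _ _). Qed.

(** * Codes of linear representations *)

Lemma pickle_linrep k r (v : 'rV[int]_r) (w : 'cV[int]_r) (M : k.-tuple 'M[int]_r) :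
  pickle (existT _ r ((v, w), M) : linrep k) =
  CodeSeq.code [:: r; CodeSeq.code [:: CodeSeq.code [:: pickle v; pickle w]; pickle M]].
Proof. by []. Qed.

(** The coding of finite functions tags each value with its argument, here the position in row [i]
    and column 0. *)
Definition entry_code (i c : nat) : nat :=
  CodeSeq.code [:: CodeSeq.code [:: i; 0]; c].

Lemma pickle_col r (w : 'cV[int]_r) :
  pickle w = CodeSeq.code
    [seq entry_code (val i) (pickle (w i ord0)) | i : 'I_r <- enum 'I_r].
Proof.
transitivity (CodeSeq.code [seq CodeSeq.code [:: pickle ij; pickle (w ij.1 ij.2)]
                           | ij : ('I_r * 'I_1)%type <- enum {: 'I_r * 'I_1}]).
  rewrite [pickle w]/pickle /=; congr CodeSeq.code.
  have -> : \val (tfgraph (mx_val w)) =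
      [seq total_fun (mx_val w) ij | ij <- enum {: 'I_r * 'I_1}] by [].
  by rewrite -map_comp; apply: eq_map => -[i j] /=; rewrite /fun_of_matrix.
have e1 : enum 'I_1 = [:: ord0] by apply: (inj_map val_inj); rewrite val_enum_ord.
(* The enumeration of the product type unfolds to the product of the enumerations. *)
rewrite enumT unlock; congr CodeSeq.code.
transitivity ([seq CodeSeq.code [:: pickle ij; pickle (w ij.1 ij.2)]
    | ij : ('I_r * 'I_1)%type <- [seq (i, j) | i <- enum 'I_r, j <- enum 'I_1]]); first by [].
rewrite e1.
by elim: (enum 'I_r) => //= i s ->.
Qed.

(** [rest] is chosen before [a] and [b]: replacing the first two entries leaves the tail of the code
    unchanged. The default of [nth] keeps the old entries from index 2 on. *)
Lemma pickle_col2 r (w : 'cV[int]_r.+2) : exists rest,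
  forall a b, pickle (\col_(i < r.+2) nth (w i ord0) [:: a; b] i)%R =
  CodeSeq.code [:: entry_code 0 (pickle a), entry_code 1 (pickle b) & rest].
Proof.
exists [seq entry_code (val i) (pickle (w i ord0)) | i : 'I_r.+2 <- drop 2 (enum 'I_r.+2)] => a b.
rewrite pickle_col; congr CodeSeq.code.
rewrite !enum_ordSl /= !mxE /= drop0; congr [:: _, _ & _].
rewrite -!map_comp; apply: eq_map => i.
by rewrite /= mxE /= nth_nil.
Qed.

(** Decodes down to the column vector, puts the input and its square in place of the first two
    entries, and encodes again. In [entry], a nonnegative integer [c] is the pair of options
    [Some c] and [None], and an option is a list of length at most one. *)
Definition prf_diag : prf :=
  let t1 := PComp prf_tl [:: PProj 0] in
  let p := PComp prf_hd [:: t1] in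
  let vw := PComp prf_hd [:: p] in
  let w := PComp prf_hd [:: PComp prf_tl [:: vw]] in
  let entry i c := prf_list [:: prf_list [:: prf_nat i; PZero] PZero;
                              prf_list [:: prf_list [:: c] PZero; PZero] PZero] PZero in
  let w' := prf_list [:: entry 0 (PProj 0);
                         entry 1 (PComp prf_mul [:: PProj 0; PProj 0])]
                     (PComp prf_tl [:: PComp prf_tl [:: w]]) in
  prf_list [:: PComp prf_hd [:: PProj 0];
     prf_list [:: prf_list [:: PComp prf_hd [:: vw]; w'] PZero;
                  PComp prf_hd [:: PComp prf_tl [:: p]]] PZero] PZero.

Lemma eval_diag k r (v : 'rV[int]_r.+2) (w : 'cV[int]_r.+2) (M : k.-tuple 'M[int]_r.+2) :
  let L a b : linrep k :=
    existT _ r.+2 (v, \col_(i < r.+2) nth (w i ord0) [:: Posz a; Posz b] i, M)%R in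
  forall a b, let c := pickle (L a b) in
  eval prf_diag [:: c] (pickle (L c (c * c))).
Proof.
move=> L a b c.
have [rest Hw] := pickle_col2 w.
have [cP dP] : c = pickle (L a b) /\ forall d e, pickle (L d e) = CodeSeq.code [:: r.+2; CodeSeq.code
   [:: CodeSeq.code [:: pickle v; CodeSeq.code
      [:: entry_code 0 (pickle (Posz d)), entry_code 1 (pickle (Posz e)) & rest]]; pickle M]].
  by split=> // d e; rewrite pickle_linrep Hw.
(* [c] becomes a variable with a known list form, so that it can occur both as the code to be
   decoded and as a new entry. *)
rewrite dP; rewrite dP in cP; move: c cP => d cP {dP Hw L}.
have e0 : eval (PProj 0) [:: d] d := ev_proj 0 [:: d].
have Z : eval PZero [:: d] (CodeSeq.code [::]) := ev_zero [:: d].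
have e1 := e0; rewrite [X in eval _ _ X]cP in e1.
have et := eval_tl_of e1.
have ep := eval_hd_of et.
have evw := eval_hd_of ep.
have ew := eval_hd_of (eval_tl_of evw).
have em := eval_comp2 e0 e0 (eval_mul d d).
do !first [exact: Z | exact: e0 | exact: em | exact: (eval_nat _ _)
  | exact: (eval_hd_of e1) | exact: (eval_hd_of evw) | exact: (eval_hd_of (eval_tl_of ep))
  | exact: (eval_tl_of (eval_tl_of ew)) | apply: eval_cons_of].
Qed.

(** * Compilation to register programs *)

(** Nondeterministic programs: [Star] repeats any number of times and [Chk] blocks unless two
    registers agree. A loop followed by a check acts as a while loop. *)
Inductive prog : Type :=
| Asg of nat & nat & int
| Chk of nat & nat
| Seq of prog & prog
| Star of prog.

Definition state := nat -> int.

Definition upd (z : state) (r : nat) (x : int) : state :=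
  fun i => if i == r then x else z i.

(* Registers are offset by one in assignments, so that register 0, which holds
   the constant 1 making all maps homogeneous, is never written. *)
Definition assign (r s : nat) (c : int) (z : state) : state :=
  upd z r.+1 (z s + c * z 0)%R.

Inductive sem : prog -> state -> state -> Prop :=
| sem_asg r s c z : sem (Asg r s c) z (assign r s c z)
| sem_chk r s z : z r = z s -> sem (Chk r s) z z
| sem_seq e1 e2 z1 z2 z3 : sem e1 z1 z2 -> sem e2 z2 z3 -> sem (Seq e1 e2) z1 z3
| sem_star0 e z : sem (Star e) z z
| sem_starS e z1 z2 z3 :
    sem e z1 z2 -> sem (Star e) z2 z3 -> sem (Star e) z1 z3.

Lemma sem_asgE r s c z z' : sem (Asg r s c) z z' -> z' = assign r s c z.
Proof. by move=> H; inversion H. Qed.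

Lemma sem_chkE r s z z' : sem (Chk r s) z z' -> z r = z s /\ z' = z.
Proof. by move=> H; inversion H; subst. Qed.

Lemma sem_seqE e1 e2 z z' :
  sem (Seq e1 e2) z z' -> exists2 z1, sem e1 z z1 & sem e2 z1 z'.
Proof. by move=> H; inversion H; subst; eexists; eassumption. Qed.

Lemma sem_star_inv e (I : state -> Prop) z z' :
  (forall z1 z2, I z1 -> sem e z1 z2 -> I z2) -> I z -> sem (Star e) z z' -> I z'.
Proof.
move=> HI Iz; move E: (Star e) => s H.
elim: H E Iz => // [e1 z1 z2 z3 H1 _ _ IH [E] Iz]; subst e1.
by apply: IH => //; apply: HI H1.
Qed.

Lemma sem_star_rcons e z1 z2 z3 : sem (Star e) z1 z2 -> sem e z2 z3 -> sem (Star e) z1 z3.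
Proof.
move E: (Star e) => s H; elim: H E z3 => //.
  by move=> e1 z [<-] z3 H; apply: sem_starS H _; apply: sem_star0.
by move=> e1 y1 y2 y3 H1 _ _ IH [E] z3 H; subst; apply: sem_starS H1 (IH _ _ H).
Qed.

(** The compiler is a parameter so that the recursion of [compile] through the list is structural.
    [Chk 0 0] does nothing. *)
Definition compile_args (cmp : prf -> seq nat -> nat -> prog) :=
  fix args (gs : seq prf) (rs : seq nat) (b : nat) : prog :=
    if gs is g :: gs' then Seq (cmp g rs b) (args gs' rs b.+1) else Chk 0 0.

(* [compile p rs b] evaluates [p] on the registers [rs], leaves the result in
   register [b.+1] and may only modify registers beyond [b]; register 1 holds 0.
   A [PMu] body is left through the inner loop only if its value is positive. *)
Fixpoint compile (p : prf) (rs : seq nat) (b : nat) : prog :=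
  match p with
  | PZero => Asg b 1 0%R
  | PSucc => Asg b (head 1 rs) 1%R
  | PProj i => Asg b (nth 1 rs i) 0%R
  | PComp f gs =>
      Seq (compile_args compile gs rs b)
        (Seq (compile f (iota b.+1 (size gs)) (b + size gs))
             (Asg b (b + size gs).+1 0%R))
  | PPrim f g =>
      if rs is r :: rs' then
        Seq (compile f rs' b)
          (Seq (Asg b.+1 1 0%R)
            (Seq (Star (Seq (compile g [:: b.+2, b.+1 & rs'] b.+2)
                       (Seq (Asg b b.+3 0%R) (Asg b.+1 b.+2 1%R))))
                 (Chk b.+2 r)))
      else Chk 0 1
  | PMu f =>
      let body := compile f (b.+1 :: rs) b.+1 in
      Seq (Asg b 1 0%R)
        (Seq (Star (Seq body
                (Seq (Asg b.+1 b.+2 (-1)%R)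
                  (Seq (Star (Asg b.+1 b.+2 (-1)%R))
                    (Seq (Chk b.+2 1) (Asg b b.+1 1%R))))))
          (Seq body (Chk b.+2 1)))
  end.

(** With [0 < b], code that writes only beyond [b] preserves the constants in registers 0 and 1. The
    last equation also makes the two lists equally long. *)
Definition ready (z : state) (b : nat) (rs xs : seq nat) : Prop :=
  [/\ z 0 = 1%R, z 1 = 0%R, 0 < b, all (fun r => r <= b) rs
    & map z rs = map Posz xs].

Definition frame (b : nat) (z z' : state) : Prop := forall r, r <= b -> z' r = z r.

Lemma ready_frame b z z' rs xs : frame b z z' -> ready z b rs xs -> ready z' b rs xs.
Proof.
move=> F [z0 z1 b0 a e]; split => //; rewrite ?F // -e.
by apply/eq_in_map => r /(allP a); apply: F.
Qed.

Lemma ready_le b b' z rs xs : b <= b' -> ready z b rs xs -> ready z b' rs xs.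
Proof.
move=> le [z0 z1 b0 a e]; split => //; first exact: leq_trans b0 le.
by apply: sub_all a => r; move=> h; apply: leq_trans h le.
Qed.

Lemma frame_trans b z1 z2 z3 : frame b z1 z2 -> frame b z2 z3 -> frame b z1 z3.
Proof. by move=> F G r le; rewrite G // F. Qed.

Lemma frame_le b b' z z' : b <= b' -> frame b' z z' -> frame b z z'.
Proof. by move=> le F r h; apply: F; apply: leq_trans h le. Qed.

Lemma frame_assign b r s c z : b <= r -> frame b z (assign r s c z).
Proof. by move=> le i li; rewrite /assign /upd; case: eqP => // E; lia. Qed.

Lemma assign_val r s c z : assign r s c z r.+1 = (z s + c * z 0)%R.
Proof. by rewrite /assign /upd eqxx. Qed.

Lemma assign_other r s c z i : i != r.+1 -> assign r s c z i = z i.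
Proof. by rewrite /assign /upd => /negPf ->. Qed.

Lemma ready_cons z b r rs x xs :
  ready z b (r :: rs) (x :: xs) <-> [/\ r <= b, z r = x & ready z b rs xs].
Proof.
split=> [[z0 z1 b0 /andP [l a] [e1 e2]]|[l e [z0 z1 b0 a es]]]; split=> //=.
  by rewrite l.
by rewrite e es.
Qed.

(** The two defaults agree: a missing argument counts as 0, the content of register 1. *)
Lemma ready_nth z b rs xs i : ready z b rs xs -> z (nth 1 rs i) = nth 0 xs i.
Proof.
move=> [_ z1 _ _ e]; have es : size rs = size xs by rewrite -(size_map z) e size_map.
case: (ltnP i (size rs)) => lt.
  by rewrite -(nth_map _ (Posz 0)) // e (nth_map 0) // -es.
by rewrite !nth_default -?es.
Qed.

(** Soundness concerns every completed run, completeness a single one: wrong guesses of iteration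
    counts are stopped by the checks. *)
Definition compile_sound (p : prf) := forall rs b z z' xs,
  ready z b rs xs -> sem (compile p rs b) z z' ->
  exists y : nat, [/\ eval p xs y, z' b.+1 = y & frame b z z'].

Definition compile_complete (p : prf) := forall rs b z xs y,
  ready z b rs xs -> eval p xs y ->
  exists z', [/\ sem (compile p rs b) z z', z' b.+1 = y & frame b z z'].

Lemma compile_args_sound gs :
  foldr (fun g Q => compile_sound g /\ Q) True gs -> forall rs b z z' xs,
  ready z b rs xs -> sem (compile_args compile gs rs b) z z' ->
  exists ys : seq nat, [/\ eval_list gs xs ys, frame b z z' &
    ready z' (b + size gs) (iota b.+1 (size gs)) ys].
Proof.
elim: gs => [|g gs IH] /= H rs b z z' xs R S.
  case/sem_chkE: S => _ ->; exists [::]; split=> //; first exact: evl_nil.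
  by case: R => *; split; rewrite ?addn0.
case: H => Hg Hgs; case/sem_seqE: S => z1 S1 S2.
have [y [ey zy F]] := Hg _ _ _ _ _ R S1.
have R1 := ready_le (leqnSn b) (ready_frame F R).
have [ys [eys F1 R2]] := IH Hgs _ _ _ _ _ R1 S2.
exists (y :: ys); split; first exact: evl_cons.
  by apply: frame_trans F (frame_le (leqnSn b) F1).
apply/ready_cons; split; first lia; first by rewrite F1.
by apply: ready_le R2; lia.
Qed.

Lemma compile_args_complete gs :
  foldr (fun g Q => compile_complete g /\ Q) True gs -> forall rs b z xs ys,
  ready z b rs xs -> eval_list gs xs ys ->
  exists z', [/\ sem (compile_args compile gs rs b) z z', frame b z z' &
    ready z' (b + size gs) (iota b.+1 (size gs)) ys].
Proof.
elim: gs => [|g gs IH] /= H rs b z xs ys R S.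
  inversion S; subst; exists z; split=> //; first exact: sem_chk.
  by case: R => *; split; rewrite ?addn0.
inversion S as [|? ? ? y ys' ey eys]; subst; case: H => Hg Hgs.
have [z1 [S1 zy F]] := Hg _ _ _ _ _ R ey.
have R1 := ready_le (leqnSn b) (ready_frame F R).
have [z2 [S2 F1 R2]] := IH Hgs _ _ _ _ _ R1 eys.
exists z2; split; first exact: sem_seq S1 S2.
  by apply: frame_trans F (frame_le (leqnSn b) F1).
apply/ready_cons; split; first lia; first by rewrite F1.
by apply: ready_le R2; lia.
Qed.

Lemma ready0 z b rs xs : ready z b rs xs -> z 0 = 1%R. Proof. by case. Qed.
Lemma ready1 z b rs xs : ready z b rs xs -> z 1 = 0%R. Proof. by case. Qed.

Lemma compileP_sound p : compile_sound p.
Proof.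
elim/prf_nested_ind: p => [||i|f gs IHf IHgs|f g IHf IHg|f IHf] rs b z z' xs R S.
- move/sem_asgE: S => ->; exists 0; split; [exact: ev_zero | | exact: frame_assign].
  by rewrite assign_val (ready1 R); lia.
- move/sem_asgE: S => ->; exists (head 0 xs).+1; split; [exact: ev_succ | | exact: frame_assign].
  by rewrite assign_val (ready0 R) -nth0 (ready_nth 0 R) nth0; lia.
- move/sem_asgE: S => ->; exists (nth 0 xs i); split; [exact: ev_proj | | exact: frame_assign].
  by rewrite assign_val (ready_nth i R); lia.
- case/sem_seqE: S => z1 S1 /sem_seqE [z2 S2 /sem_asgE ->].
  have [ys [e1 F1 R1]] := compile_args_sound IHgs R S1.
  have [y [e2 zy F2]] := IHf _ _ _ _ _ R1 S2.
  exists y; split; first exact: ev_comp e1 e2.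
    by rewrite assign_val zy; lia.
  apply: frame_trans (frame_assign _ _ _ (leqnn b)).
  by apply: frame_trans F1 (frame_le _ F2); lia.
- case: rs R S => [|r rs] R S /=.
    (* [Chk 0 1] compares 1 with 0 and blocks, as primitive recursion has no value on an empty
       argument list. *)
    by case/sem_chkE: S => e; rewrite (ready0 R) (ready1 R) in e.
  case: xs R => [|x xs] R; first by case: R.
  case/ready_cons: R => lr zr R.
  case/sem_seqE: S => z1 S1 /sem_seqE [z2 /sem_asgE E2 /sem_seqE [z3 S3 /sem_chkE [E ->]]].
  have [y0 [ey0 zy0 F0]] := IHf _ _ _ _ _ R S1.
  pose I (z : state) := exists i y : nat, [/\ eval (PPrim f g) (i :: xs) y, z b.+2 = i,
     z b.+1 = y & frame b z1 z].
  have R1 := ready_frame F0 R.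
  have I2 : I z2.
    exists 0, y0; rewrite E2; split; first exact: ev_prim0.
    - by rewrite assign_val (ready1 R1); lia.
    - by rewrite (frame_assign _ _ _ (leqnn b.+1)).
    - exact: frame_assign.
  have {S3} : I z3.
    apply: sem_star_inv I2 S3 => {}z2 {E2 E}z3 [i [y [ey zi zy F]]].
    case/sem_seqE => z4 S4 /sem_seqE [z5 /sem_asgE -> /sem_asgE ->].
    have R2 : ready z2 b.+2 [:: b.+2, b.+1 & rs] [:: i, y & xs].
      apply/ready_cons; split => //; apply/ready_cons; split => //.
      by apply: ready_le (ready_frame F R1); lia.
    have [y' [ey' zy' F']] := IHg _ _ _ _ _ R2 S4.
    exists i.+1, y'; split; first exact: ev_primS ey ey'.
    - rewrite assign_val !assign_other ?F' ?zi ?(ready0 R2); lia.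
    - rewrite assign_other ?assign_val ?zy'; lia.
    - apply: frame_trans F _; apply: frame_trans (frame_le _ F') _; first lia.
      by apply: frame_trans (frame_assign _ _ _ _) (frame_assign _ _ _ _); lia.
  (* The loop may stop after any number of rounds; the final check makes the counter equal to the
     recursion argument. *)
  case=> i [y [ey zi zy F]]; exists y; split => //; last exact: frame_trans F0 F.
  move: E; rewrite zi F // F0 // zr => -[<-]; exact: ey.
- case/sem_seqE: S => z1 /sem_asgE E1 /sem_seqE [z2 S2 /sem_seqE [z3 S3 /sem_chkE [E ->]]].
  pose I (z' : state) := exists i : nat, [/\ z' b.+1 = i, frame b z z' &
     forall j, j < i -> exists2 v, eval f (j :: xs) v & v <> 0].
  have I1 : I z1.
    exists 0; rewrite E1; split=> //; last exact: frame_assign.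
    by rewrite assign_val (ready1 R); lia.
  have Rn (z4 : state) (i : nat) : z4 b.+1 = i -> frame b z z4 -> ready z4 b.+1 (b.+1 :: rs) (i :: xs).
    move=> zi F; apply/ready_cons; split=> //.
    exact: ready_le (leqnSn b) (ready_frame F R).
  have {S2} : I z2.
    apply: sem_star_inv I1 S2 => {E1}z1 {S3 E}z2 [i [zi F lt]].
    case/sem_seqE => z4 S4 /sem_seqE [z5 /sem_asgE E5 /sem_seqE [z6 S6]].
    case/sem_seqE => z7 /sem_chkE [E7 ->] /sem_asgE ->.
    have R1 := Rn _ _ zi F.
    have [v [ev zv F4]] := IHf _ _ _ _ _ R1 S4.
    (* The value is decremented at least once, so it was positive if the check finds 0
       afterwards. *)
    have {S6} [F6 l6] : frame b.+1 z4 z6 /\ (z6 b.+2 < v)%R.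
      have [J0 J1] : frame b.+1 z4 z5 /\ (z5 b.+2 < v)%R.
        rewrite E5; split; first exact: frame_assign.
        by rewrite assign_val zv (ready0 (ready_frame F4 R1)); lia.
      apply: (sem_star_inv (I := fun z => frame b.+1 z4 z /\ (z b.+2 < v)%R)) S6 => //.
      move=> y1 y2 [Fy ly] /sem_asgE ->; split; first exact: frame_trans Fy (frame_assign _ _ _ _).
      rewrite assign_val (ready0 (ready_frame (frame_trans F4 Fy) R1)); lia.
    have R6 := ready_frame (frame_trans F4 F6) R1.
    exists i.+1; split.
    - by rewrite assign_val F6 // F4 // zi (ready0 R6); lia.
    - apply: frame_trans F _; apply: frame_trans (frame_le (leqnSn b) F4) _.
      by apply: frame_trans (frame_le (leqnSn b) F6) (frame_assign _ _ _ _).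
    move=> j; rewrite ltnS leq_eqVlt => /orP [/eqP ->|]; last exact: lt.
    by exists v => // v0; move: l6; rewrite E7 (ready1 R6) v0.
  case=> i [zi F lt]; have [v [ev zv F3]] := IHf _ _ _ _ _ (Rn _ _ zi F) S3.
  exists i; split; last exact: frame_trans F (frame_le (leqnSn b) F3).
    apply: ev_mu lt; move: E; rewrite zv F3 ?F ?(ready1 R); [by case=> <- | by case: R | by case: R; lia].
  by rewrite F3.
Qed.

Lemma sem_star_decr b z n : z 0 = 1%R -> z b.+2 = Posz n ->
  exists z', [/\ sem (Star (Asg b.+1 b.+2 (-1)%R)) z z', z' b.+2 = 0%R & frame b.+1 z z'].
Proof.
elim: n z => [|n IH] z z0 zn; first by exists z; split=> //; apply: sem_star0.
have [//||z' [S zb F]] := IH (assign b.+1 b.+2 (-1)%R z); first by rewrite assign_val zn z0; lia.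
exists z'; split=> //; first by apply: sem_starS S; apply: sem_asg.
by apply: frame_trans F; apply: frame_assign.
Qed.

Lemma compileP_complete p : compile_complete p.
Proof.
elim/prf_nested_ind: p => [||i|f gs IHf IHgs|f g IHf IHg|f IHf] rs b z xs y R S.
- inversion S; subst; exists (assign b 1 0%R z); split; [exact: sem_asg| |exact: frame_assign].
  by rewrite assign_val (ready1 R); lia.
- inversion S; subst; eexists; split; [exact: sem_asg| |exact: frame_assign].
  by rewrite assign_val (ready0 R) -nth0 (ready_nth 0 R) nth0; lia.
- inversion S; subst; eexists; split; [exact: sem_asg| |exact: frame_assign].
  by rewrite assign_val (ready_nth i R); lia.
- inversion S as [| | |? ? ? ys ? e1 e2| | |]; subst.
  have [z1 [S1 F1 R1]] := compile_args_complete IHgs R e1.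
  have [z2 [S2 zy F2]] := IHf _ _ _ _ _ R1 e2.
  exists (assign b (b + size gs).+1 0%R z2); split.
  - exact: sem_seq S1 (sem_seq S2 (sem_asg _ _ _ _)).
  - by rewrite assign_val zy; lia.
  apply: frame_trans (frame_assign _ _ _ (leqnn b)).
  by apply: frame_trans F1 (frame_le _ F2); lia.
- case: xs R S => [|x xs] R S; first by inversion S.
  case: rs R => [|r rs] R; first by case: R.
  case/ready_cons: R => lr zr R.
  set e := Seq (compile g [:: b.+2, b.+1 & rs] b.+2) (Seq (Asg b b.+3 0%R) (Asg b.+1 b.+2 1%R)).
  (* The loop is run for exactly [x] rounds, by induction on [x]; the exit check is made only at the
     end. *)
  suff [z1 [z3 [S1 S2 zx zy F]]] : exists z1 z3, [/\ sem (compile f rs b) z z1,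
      sem (Star e) (assign b.+1 1 0%R z1) z3, z3 b.+2 = x, z3 b.+1 = y & frame b z z3].
    exists z3; split=> //; apply: sem_seq S1 (sem_seq (sem_asg _ _ _ _) (sem_seq S2 _)).
    by apply: sem_chk; rewrite zx F.
  elim: x y S {zr} => [|x IH] y S.
    inversion S as [| | | |? ? ? ? ey| |]; subst.
    have [z1 [S1 zy F]] := IHf _ _ _ _ _ R ey.
    exists z1, (assign b.+1 1 0%R z1); split=> //; first exact: sem_star0.
    - by rewrite assign_val (ready1 (ready_frame F R)); lia.
    - by rewrite assign_other //; lia.
    by apply: frame_trans F (frame_assign _ _ _ _).
  inversion S as [| | | | |? ? ? ? y' ? e1 e2|]; subst.
  have [z1 [z2 [S1 S2 zx zy F]]] := IH _ e1.
  have R2 : ready z2 b.+2 [:: b.+2, b.+1 & rs] [:: x, y' & xs].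
    apply/ready_cons; split => //; apply/ready_cons; split => //.
    by apply: ready_le (ready_frame F R); lia.
  have [z3 [S3 zy' F']] := IHg _ _ _ _ _ R2 e2.
  exists z1, (assign b.+1 b.+2 1%R (assign b b.+3 0%R z3)); split=> //.
  - apply: sem_star_rcons S2 _; apply: sem_seq S3 _.
    by apply: sem_seq (sem_asg _ _ _ _) (sem_asg _ _ _ _).
  - by rewrite assign_val !assign_other ?F' ?zx ?(ready0 R2); lia.
  - by rewrite assign_other ?assign_val ?zy'; lia.
  apply: frame_trans F _; apply: frame_trans (frame_le _ F') _; first lia.
  by apply: frame_trans (frame_assign _ _ _ _) (frame_assign _ _ _ _); lia.
- inversion S as [| | | | | |? ? ? ey lt]; subst.
  have Rn (z4 : state) (i : nat) : z4 b.+1 = i -> frame b z z4 -> ready z4 b.+1 (b.+1 :: rs) (i :: xs).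
    move=> zi F; apply/ready_cons; split=> //.
    exact: ready_le (leqnSn b) (ready_frame F R).
  set body := compile f (b.+1 :: rs) b.+1.
  set e := Seq body (Seq (Asg b.+1 b.+2 (-1)%R) (Seq (Star (Asg b.+1 b.+2 (-1)%R))
             (Seq (Chk b.+2 1) (Asg b b.+1 1%R)))).
  have H i : i <= y -> exists z2, [/\ sem (Star e) (assign b 1 0%R z) z2, z2 b.+1 = i
      & frame b z z2].
    elim: i => [|i IH] li.
      exists (assign b 1 0%R z); split; [exact: sem_star0| |exact: frame_assign].
      by rewrite assign_val (ready1 R); lia.
    have [z2 [S2 zi F]] := IH (ltnW li).
    have R2 := Rn _ _ zi F; have [v ev v0] := lt _ li.
    have [z3 [S3 zv F3]] := IHf _ _ _ _ _ R2 ev.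
    have R3 := ready_frame F3 R2; have F4 := @frame_assign b.+1 b.+1 b.+2 (-1)%R z3 (leqnn _).
    (* One decrement precedes the inner loop, so [v.-1] of them remain; [v] is nonzero here. *)
    have [|z4 [S4 z40 F5]] := @sem_star_decr b _ v.-1 (ready0 (ready_frame F4 R3)).
      by rewrite assign_val zv (ready0 R3); lia.
    have R5 := ready_frame F5 (ready_frame F4 R3).
    exists (assign b b.+1 1%R z4); split.
    - apply: sem_star_rcons S2 _; apply: sem_seq S3 (sem_seq (sem_asg _ _ _ _) (sem_seq S4 _)).
      by apply: sem_seq (sem_asg _ _ _ _); apply: sem_chk; rewrite z40 (ready1 R5).
    - by rewrite assign_val F5 // F4 // F3 // zi (ready0 R5); lia.
    apply: frame_trans F _; apply: frame_trans (frame_assign _ _ _ (leqnn b)).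
    by apply: frame_le (leqnSn b) _; apply: frame_trans F3 (frame_trans F4 F5).
  have [z2 [S2 zi F]] := H y (leqnn y).
  have R2 := Rn _ _ zi F; have [z3 [S3 zv F3]] := IHf _ _ _ _ _ R2 ey.
  exists z3; split; last exact: frame_trans F (frame_le (leqnSn b) F3).
    apply: sem_seq (sem_asg _ _ _ _) (sem_seq S2 (sem_seq S3 _)).
    by apply: sem_chk; rewrite zv (ready1 (ready_frame F3 R2)).
  by rewrite F3.
Qed.

(** * Control by digits *)

(** Flowchart instructions with absolute addresses; a fork goes to its first target on digit 0 and
    to its second one on any other digit. *)
Inductive node : Type :=
| NAsg of nat & nat & int
| NChk of nat & nat
| NFork of nat & nat.

Fixpoint plen (e : prog) : nat :=
  match e with
  | Asg _ _ _ | Chk _ _ => 1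
  | Seq e1 e2 => plen e1 + plen e2
  | Star e => (plen e).+2
  end.

(** The code is placed at address [a]. A loop starts with a fork between its body and its exit and
    ends with [NFork a a], an unconditional jump back. *)
Fixpoint flat (e : prog) (a : nat) : seq node :=
  match e with
  | Asg r s c => [:: NAsg r s c]
  | Chk r s => [:: NChk r s]
  | Seq e1 e2 => flat e1 a ++ flat e2 (a + plen e1)
  | Star e => NFork a.+1 (a + (plen e).+2) :: rcons (flat e a.+1) (NFork a a)
  end.

Lemma size_flat e a : size (flat e a) = plen e.
Proof.
elim: e a => //= [e1 IH1 e2 IH2|e IH] a; first by rewrite size_cat IH1 IH2.
by rewrite size_rcons IH.
Qed.

(** By the default, the machine stays in place beyond the end of the code. *)
Definition node_at (code : seq node) (pc : nat) : node := nth (NFork pc pc) code pc.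

Definition next_pc (nd : node) (d : bool) (pc : nat) : nat :=
  if nd is NFork q0 q1 then if d then q1 else q0 else pc.+1.

Definition next_state (nd : node) (z : state) : state :=
  if nd is NAsg r s c then assign r s c z else z.

Definition node_err (nd : node) (z : state) : int :=
  if nd is NChk r s then ((z r - z s) ^+ 2)%R else 0%R.

Definition config : Type := nat * state * int.

(* Running past a failed [NChk] is allowed, but leaves a positive error. *)
Definition step (code : seq node) (x : config) (d : bool) : config :=
  let: (pc, z, E) := x in let nd := node_at code pc in
  (next_pc nd d pc, next_state nd z, E + node_err nd z)%R.

Definition run (code : seq node) (x : config) (ds : seq bool) : config :=
  foldl (step code) x ds.

Definition accept (code : seq node) (x : config) : Prop :=
  x.1.1 = size code /\ x.2 = 0%R.

Definition accepts (code : seq node) (n pc : nat) (z : state) : Prop :=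
  exists2 ds, size ds = n & accept code (run code (pc, z, 0%R) ds).

Lemma node_err_ge0 nd z : (0 <= node_err nd z)%R.
Proof. by case: nd => * //=; apply: sqr_ge0. Qed.

Lemma run_err code ds pc z E :
  run code (pc, z, E) ds =
  ((run code (pc, z, 0%R) ds).1, E + (run code (pc, z, 0%R) ds).2)%R.
Proof.
elim: ds pc z E => [|d ds IH] pc z E /=; first by rewrite addr0.
by rewrite IH [in RHS]IH /= add0r addrA.
Qed.

Lemma run_err_ge0 code ds pc z : (0 <= (run code (pc, z, 0) ds).2)%R.
Proof.
elim: ds pc z => [|d ds IH] pc z //=; rewrite run_err /= add0r.
by apply: addr_ge0 (node_err_ge0 _ _) (IH _ _).
Qed.

(** Errors are sums of squares, so the total vanishes only if every step contributes 0. *)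
Lemma acceptsS code n pc z :
  accepts code n.+1 pc z <-> node_err (node_at code pc) z = 0%R /\
  exists d, accepts code n (next_pc (node_at code pc) d pc) (next_state (node_at code pc) z).
Proof.
split=> [[[|d ds] //= [sz]]|[e0 [d [ds sz A]]]]; last first.
  by exists (d :: ds); rewrite /= ?sz // e0 addr0.
rewrite /accept run_err /= add0r => -[A1 /eqP].
rewrite paddr_eq0 ?node_err_ge0 ?run_err_ge0 // => /andP [/eqP e1 /eqP e2].
by split=> //; exists d, ds.
Qed.

Lemma accepts_lt code n pc z : pc < size code -> accepts code n pc z ->
  exists2 m, n = m.+1 & node_err (node_at code pc) z = 0%R /\
  exists d, accepts code m (next_pc (node_at code pc) d pc) (next_state (node_at code pc) z).
Proof.
case: n => [|n] lt; last by move/acceptsS => H; exists n.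
by case=> ds /size0nil -> [/= e _]; rewrite e ltnn in lt.
Qed.

Lemma node_at_cat pre nd post : node_at (pre ++ nd :: post) (size pre) = nd.
Proof. by rewrite /node_at nth_cat ltnn subnn. Qed.

(** The bound [m <= n] serves the loop case, by strong induction on [n]: each round returns to the
    same address with fewer steps left. *)
Lemma accepts_sem code e pre post n z :
  code = pre ++ flat e (size pre) ++ post -> accepts code n (size pre) z ->
  exists z' m, [/\ m <= n, sem e z z' & accepts code m (size pre + plen e) z'].
Proof.
elim: e pre post n z => [r s c|r s|e1 IH1 e2 IH2|e IH] pre post n z E A.
- have lt : size pre < size code by rewrite E !size_cat /=; lia.
  have [m -> [_ [d]]] := accepts_lt lt A; rewrite E /= node_at_cat -E /= => A'.
  by exists (assign r s c z), m; split; rewrite ?addn1 //; apply: sem_asg.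
- have lt : size pre < size code by rewrite E !size_cat /=; lia.
  have [m -> [e0 [d]]] := accepts_lt lt A; move: e0.
  rewrite E /= node_at_cat -E /= => e0 A'.
  exists z, m; split; rewrite ?addn1 //; apply: sem_chk.
  by apply/eqP; rewrite -subr_eq0 -sqrf_eq0 e0.
- have [|z1 [m1 [l1 S1 A1]]] := IH1 pre (flat e2 (size pre + plen e1) ++ post) _ _ _ A.
    by rewrite E /= -catA.
  have sz : size (pre ++ flat e1 (size pre)) = size pre + plen e1.
    by rewrite size_cat size_flat.
  rewrite -sz in A1.
  have [|z2 [m2 [l2 S2 A2]]] := IH2 (pre ++ flat e1 (size pre)) post _ _ _ A1.
    by rewrite E sz /= -!catA.
  exists z2, m2; split; [exact: leq_trans l2 l1|exact: sem_seq S1 S2|].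
  by rewrite /= addnA -sz.
(* Three splittings of the code: at the entry fork, around the body, and at the jump back. *)
have Ef : code = pre ++ NFork (size pre).+1 (size pre + (plen e).+2) ::
           (flat e (size pre).+1 ++ NFork (size pre) (size pre) :: post).
  by rewrite E /= -cats1 -catA.
have Eb : code = rcons pre (NFork (size pre).+1 (size pre + (plen e).+2)) ++
     flat e (size (rcons pre (NFork (size pre).+1 (size pre + (plen e).+2)))) ++
     NFork (size pre) (size pre) :: post by rewrite size_rcons cat_rcons.
have Ej : code = (rcons pre (NFork (size pre).+1 (size pre + (plen e).+2)) ++
     flat e (size pre).+1) ++ NFork (size pre) (size pre) :: post.
  by rewrite -catA cat_rcons.
have sj : size (rcons pre (NFork (size pre).+1 (size pre + (plen e).+2)) ++
     flat e (size pre).+1) = (size pre).+1 + plen e by rewrite size_cat size_rcons size_flat.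
have nf : node_at code (size pre) = NFork (size pre).+1 (size pre + (plen e).+2).
  by rewrite Ef node_at_cat.
have nj : node_at code ((size pre).+1 + plen e) = NFork (size pre) (size pre).
  by rewrite Ej -sj node_at_cat.
have lt1 : size pre < size code by rewrite Ef size_cat /=; lia.
have lt2 : (size pre).+1 + plen e < size code by rewrite Ej size_cat sj /=; lia.
elim/ltn_ind: n z A => n IHn z A.
have [m en [_ [d]]] := accepts_lt lt1 A; rewrite nf /=; case: d => A1.
  by exists z, m; split=> //; [rewrite en | apply: sem_star0].
rewrite -(size_rcons pre (NFork (size pre).+1 (size pre + (plen e).+2))) in A1.
have [z1 [m1 [l1 S1]]] := IH _ _ _ _ Eb A1.
rewrite size_rcons => /(accepts_lt lt2) [m2 em [_ [d]]]; rewrite nj /= if_same => A2.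
have [|z2 [m3 [l3 S3 A3]]] := IHn m2 _ _ A2; first lia.
by exists z2, m3; split=> //; [lia | apply: sem_starS S1 S3].
Qed.

(** An accepting continuation is extended backwards along the derivation; each fork gets the digit
    that the derivation prescribes. *)
Lemma sem_accepts code e pre post z z' m :
  code = pre ++ flat e (size pre) ++ post -> sem e z z' ->
  accepts code m (size pre + plen e) z' -> exists n, accepts code n (size pre) z.
Proof.
move=> E S; elim: S pre post m E => {e z z'} [r s c z|r s z e0|e1 e2 z1 z2 z3 _ IH1 _ IH2|
   e z|e z1 z2 z3 _ IH1 _ IH2] pre post m E A.
- exists m.+1; apply/acceptsS; rewrite [in node_at _ _]E /= node_at_cat /=.
  by split=> //; exists true; rewrite -addn1.
- exists m.+1; apply/acceptsS; rewrite [in node_at _ _]E /= node_at_cat /=.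
  by split; [rewrite e0 subrr | exists true; rewrite -addn1].
- have sz : size (pre ++ flat e1 (size pre)) = size pre + plen e1.
    by rewrite size_cat size_flat.
  rewrite /= addnA -sz in A.
  have [|n A1] := IH2 (pre ++ flat e1 (size pre)) post _ _ A; first by rewrite E sz /= -!catA.
  rewrite sz in A1; apply: IH1 A1; rewrite {1}E /= -catA; reflexivity.
- exists m.+1; apply/acceptsS; rewrite [in node_at _ _]E /= node_at_cat /=.
  by split=> //; exists true.
have [n A1] := IH2 _ _ _ E A.
set nd := NFork (size pre).+1 (size pre + (plen e).+2).
have Eb : code = rcons pre nd ++ flat e (size (rcons pre nd)) ++ NFork (size pre) (size pre) :: post.
  by rewrite size_rcons cat_rcons E /= -cats1 -catA.
have nj : node_at code (size (rcons pre nd) + plen e) = NFork (size pre) (size pre).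
  by rewrite Eb catA -(size_flat e (size (rcons pre nd))) -size_cat node_at_cat.
have A2 : accepts code n.+1 (size (rcons pre nd) + plen e) z2.
  by apply/acceptsS; rewrite nj; split=> //; exists true.
have [n' A3] := IH1 _ _ _ Eb A2.
exists n'.+1; apply/acceptsS; rewrite [in node_at _ _]E /= node_at_cat /=.
by split=> //; exists false; rewrite size_rcons in A3.
Qed.

(** The leading digit of a number is never 0 and so offers no free binary choice. The fork at
    address 0 spends it, and the input is loaded at that step. *)
Definition prog_code (e : prog) : seq node := NFork 1 1 :: flat e 1.

Lemma prog_codeP e z :
  (exists ds, accept (prog_code e) (run (prog_code e) (1, z, 0%R) ds)) <->
  exists z', sem e z z'.
Proof.
have E : prog_code e = [:: NFork 1 1] ++ flat e (size [:: NFork 1 1]) ++ [::] by rewrite cats0.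
split=> [[ds A]|[z' S]].
  have [z' [m [_ S _]]] := accepts_sem E (ex_intro2 _ _ ds (erefl (size ds)) A).
  by exists z'.
have A0 : accepts (prog_code e) 0 (1 + plen e) z'.
  by exists [::] => //; split=> //=; rewrite size_flat.
by have [n [ds _ A]] := sem_accepts E S A0; exists ds.
Qed.

Lemma halting_code q (z : nat -> state) :
  (forall n, [/\ z n 0 = 1%R, z n 1 = 0%R & z n 2 = Posz n]) ->
  forall n, (exists ds, accept (prog_code (compile q [:: 2] 2))
     (run (prog_code (compile q [:: 2] 2)) (1, z n, 0%R) ds)) <-> exists y, eval q [:: n] y.
Proof.
move=> H n; have [z0 z1 z2] := H n.
have R : ready (z n) 2 [:: 2] [:: n] by split; rewrite //= z2.
split.
  by case/prog_codeP => z' S; have [y [ey _ _]] := compileP_sound R S; exists y.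
by case=> y ey; apply/prog_codeP; have [z' [S _ _]] := compileP_complete R ey; exists z'.
Qed.

(** * Linear representations *)

Local Open Scope ring_scope.


(** This lives in [Type], so that the coefficients can be extracted as matrix entries. *)
Definition linear_form (S : finType) (phi : (S -> int) -> int) : Type :=
  {m : S -> int | forall Y, phi Y = \sum_s m s * Y s}.

Section LinearForms.
Variable S : finType.
Implicit Types phi psi : (S -> int) -> int.

Lemma linear_form0 : @linear_form S (fun=> 0).
Proof. by exists (fun=> 0) => Y; rewrite big1 // => s _; rewrite mul0r. Qed.

Lemma linear_form_proj s : linear_form (fun Y : S -> int => Y s).
Proof.
exists (fun u => (u == s)%:R) => Y.
rewrite (bigD1 s) //= eqxx mul1r big1 ?addr0 // => u /negPf ->.
by rewrite mul0r.
Qed.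

Lemma linear_formD phi psi :
  linear_form phi -> linear_form psi -> linear_form (fun Y => phi Y + psi Y).
Proof.
case=> m Hm [n Hn]; exists (fun s => m s + n s) => Y.
by rewrite Hm Hn -big_split; apply: eq_bigr => s _; rewrite mulrDl.
Qed.

Lemma linear_formZ c phi : linear_form phi -> linear_form (fun Y => c * phi Y).
Proof.
case=> m Hm; exists (fun s => c * m s) => Y.
by rewrite Hm mulr_sumr; apply: eq_bigr => s _; rewrite mulrA.
Qed.

Lemma linear_form_sum (I : finType) (P : pred I) (phi : I -> (S -> int) -> int) :
  (forall i, linear_form (phi i)) -> linear_form (fun Y => \sum_(i | P i) phi i Y).
Proof.
move=> H; exists (fun s => \sum_(i | P i) sval (H i) s) => Y.
rewrite (eq_bigr (fun i => \sum_s sval (H i) s * Y s)) => [|i _]; last exact: (svalP (H i)).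
by rewrite exchange_big; apply: eq_bigr => s _; rewrite mulr_suml.
Qed.

End LinearForms.

Lemma digits_aux_fuel k m n fuel : (1 < k)%N -> (n <= m)%N -> (n <= fuel)%N ->
  digits_aux k fuel n = digits_aux k m n.
Proof.
move=> k1; elim: m n fuel => [|m IH] n fuel.
  by rewrite leqn0 => /eqP -> _; case: fuel.
case: fuel => [|fuel]; first by rewrite leqn0 => _ /eqP ->.
move=> lm lf /=; case: eqP => // /eqP; rewrite -lt0n => n0; congr (_ :: _).
by have lt := ltn_Pdiv k1 n0; apply: IH; rewrite -ltnS; apply: leq_trans lt _.
Qed.

Lemma digitsE k n : (1 < k)%N -> (0 < n)%N ->
  digits k n = (n %% k)%N :: digits k (n %/ k)%N.
Proof.
move=> k1 n0; rewrite {1}/digits -{1}(prednK n0) /= (gtn_eqF n0).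
congr (_ :: _); apply: digits_aux_fuel => //.
by rewrite -ltnS (prednK n0) ltn_Pdiv.
Qed.

(* The coordinates [inl _] come first in the vectors of the representation, so
   that [a] and [b] are its first two initial entries. *)
Lemma linrep_of_forms k (T : finType) (phi : nat -> 'I_2 + T -> ('I_2 + T -> int) -> int)
    (f0 : T -> int) (t0 : T) :
  (1 < k)%N -> (forall d s, linear_form (phi d s)) ->
  exists (v : 'rV[int]_(#|T|.+2)) (w : 'cV[int]_(#|T|.+2)) (M : k.-tuple 'M[int]_(#|T|.+2)),
  forall a b, exists F : nat -> 'I_2 + T -> int,
  [/\ forall i, F 0 (inl i) = nth 0 [:: a; b] i,
      forall t, F 0 (inr t) = f0 t,
      forall n s, (0 < n)%N -> F n s = phi (n %% k)%N s (F (n %/ k)%N) &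
      forall n, kreg_seq (existT _ #|T|.+2
         (v, \col_(i < #|T|.+2) nth (w i ord0) [:: a; b] i, M) : linrep k) n = F n (inr t0)].
Proof.
move=> k1 lin.
pose sof (i : 'I_(2 + #|T|)) : 'I_2 + T :=
  match split i with inl j => inl j | inr j => inr (enum_val j) end.
pose iof (s : 'I_2 + T) : 'I_(2 + #|T|) :=
  match s with inl j => lshift _ j | inr t => rshift _ (enum_rank t) end.
have sofK : cancel sof iof.
  rewrite /sof /iof => i; case: (split_ordP i) => j -> /=; rewrite ?enum_valK //;
  by [].
have iofK : cancel iof sof.
  rewrite /sof /iof => -[j|t].
    by case: split_ordP => j' /eqP; rewrite ?eq_lshift ?eq_lrshift // => /eqP ->.
  case: split_ordP => j' /eqP; rewrite ?eq_rlshift ?eq_rshift // => /eqP <-.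
  by rewrite enum_rankK.
pose Mx (d : nat) : 'M[int]_(#|T|.+2) := \matrix_(i, j) sval (lin d (sof i)) (sof j).
pose w : 'cV[int]_(#|T|.+2) := \col_i (if sof i is inr t then f0 t else 0).
exists (delta_mx ord0 (iof (inr t0))), w, [tuple Mx i | i < k] => a b.
set w' := \col_(i < #|T|.+2) nth (w i ord0) [:: a; b] i.
(* The lowest digit acts last, so [G n] arises from [G (n %/ k)] by one matrix. *)
pose G n : 'cV[int]_(#|T|.+2) :=
  foldr (fun d (acc : 'cV[int]_(#|T|.+2)) => nth 0%R [tuple Mx i | i < k] d *m acc) w' (digits k n).
exists (fun n s => G n (iof s) ord0); split.
- by move=> i; rewrite /G /= mxE /=; case: i => -[|[|]].
- by move=> t; rewrite (_ : G 0%N = w') // mxE nth_default // mxE iofK.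
- move=> n s n0; rewrite /G digitsE //= -/(G _).
  have lt : (n %% k < k)%N by rewrite ltn_mod ltnW.
  rewrite (_ : nth _ _ _ = Mx (n %% k)%N); last first.
    exact: (nth_mktuple (fun i : 'I_k => Mx i) 0 (Ordinal lt)).
  rewrite (svalP (lin _ s)) mxE.
  rewrite [RHS](reindex sof) /=; last by exists iof => x _.
  by apply: eq_bigr => j _; rewrite mxE iofK sofK.
move=> n; rewrite /kreg_seq -/(G n) mxE (bigD1 (iof (inr t0))) //= mxE !eqxx mul1r.
rewrite big1 ?addr0 // => i /negPf ne; by rewrite mxE ne andbF mul0r.
Qed.

(** Modulo 4, [f n] is [n] or [n - 1]. Hence terms two apart never agree, which excludes odd
    lengths, and adjacent ones agree only as [j] and [j + 4 * h q], which forces [h q = 0]. *)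
Lemma palindrome_iff k (f h : nat -> int) : (1 < k)%N ->
  (forall n, f n = if (n %% k == 1)%N then (k * (n %/ k))%N%:Z + 4 * h (n %/ k)%N else n%:Z) ->
  has_nontrivial_palindrome f <-> exists q, h q = 0.
Proof.
move=> k1 fE; have fE' n : f n = n%:Z \/ f n = n%:Z - 1 + 4 * h (n %/ k)%N.
  rewrite fE; case: eqP => e; [right|by left].
  have := divn_eq n k; rewrite e mulnC; move: (h _) (k * _)%N => x y; lia.
split=> [[i [len [l2 H]]]|[q h0]].
  (* Position [j] lies just left of the centre; its mirror image is [j.+1] for even and [j.+2] for
     odd lengths. *)
  have := H (len./2.-1) _; have := odd_double_half len.
  set t := len./2.-1; set j := (i + t)%N => e Ht.
  have {}Ht : f j = f (i + len - 1 - t)%N by apply: Ht; rewrite /t; lia.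
  have [ej|ej] : (i + len - 1 - t = j.+1)%N \/ (i + len - 1 - t = j.+2)%N by rewrite /j /t; lia.
    exists (j.+1 %/ k)%N; move: Ht; rewrite ej.
    case: (fE' j) => ->; case: (fE' j.+1) => ->; lia.
  exfalso; move: Ht; rewrite ej; case: (fE' j) => ->; case: (fE' j.+2) => ->; lia.
have k0 : (0 < k)%N by lia.
have f0 : f (k * q)%N = (k * q)%N by rewrite fE modnMr.
have f1 : f (k * q).+1 = (k * q)%N.
  rewrite fE -addn1 mulnC modnMDl modn_small // eqxx divnMDl // divn_small // addn0 h0.
  by rewrite mulnC; lia.
exists (k * q)%N, 2; split=> // -[|[|]] // _.
  by rewrite addn0 subn0 addn2 subn1 /= f0 f1.
by rewrite addn1 addn2 2!subn1 /= f0 f1.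
Qed.

(** * Runs as linear recurrences *)


(** One bound serves registers and addresses. [NAsg r] writes register [r.+1], hence the strict
    inequality. *)
Definition node_bound (B : nat) (nd : node) : bool :=
  match nd with
  | NAsg r s _ => (r < B)%N && (s <= B)%N
  | NChk q s | NFork q s => (q <= B)%N && (s <= B)%N
  end.

Lemma node_bound_ex (code : seq node) :
  exists B, (size code <= B)%N /\ all (node_bound B) code.
Proof.
elim: code => [|nd code [B [sB aB]]]; first by exists 0%N.
pose m := match nd with NAsg r s _ => r.+1 + s | NChk r s | NFork r s => r + s end%N.
exists (B + m).+1; split; first by rewrite /=; lia.
rewrite /=; apply/andP; split; first by case: nd @m => [r s c|r s|r s] m; rewrite /= /m; lia.
by clearbody m; apply: sub_all aB => -[r s c|r s|r s] /=; lia.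
Qed.

(** The matrix of [next_state]: row [i] for the new register, column [u] for the old one. Register 0
    carries the added constant. *)
Definition coef (nd : node) (i u : nat) : int :=
  if nd is NAsg r s c then
    if i == r.+1 then (u == s)%:R + c * (u == 0%N)%:R else (u == i)%:R
  else (u == i)%:R.

Lemma sum_delta B (z : state) (i : nat) : (i <= B)%N ->
  \sum_(u < B.+1) (u == i :> nat)%:R * z u = z i.
Proof.
move=> le; rewrite (bigD1 (inord i)) //= inordK // eqxx mul1r big1 ?addr0 // => u ne.
case: eqP => [e|_]; last by rewrite mul0r.
by move/eqP: ne; case; apply: val_inj; rewrite /= inordK.
Qed.

Lemma sum_coef B nd (z : state) (i : nat) : node_bound B nd -> (i <= B)%N ->
  \sum_(u < B.+1) coef nd i u * z u = next_state nd z i.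
Proof.
case: nd => [r s c|r s|q0 q1] /= /andP [l1 l2] li; try exact: sum_delta.
rewrite /assign /upd; case: eqP => _; last exact: sum_delta.
under eq_bigr => u _ do rewrite mulrDl -mulrA.
by rewrite big_split /= -mulr_sumr !sum_delta.
Qed.

Lemma sum_block B (P : pred 'I_B.+1) (F : 'I_B.+1 -> int) (q : nat) x : (q <= B)%N ->
  (forall p : 'I_B.+1, F p = if p == q :> nat then x else 0) ->
  \sum_(p | P p) F p = if P (inord q) then x else 0.
Proof.
move=> le HF; rewrite big_mkcond (bigD1 (inord q)) //= HF inordK // eqxx big1 ?addr0 // => p ne.
case: ifP => // _; rewrite HF; case: eqP => // e.
by move/eqP: ne; case; apply: val_inj; rewrite /= inordK.
Qed.

Section Encoding.
Variables (k : nat) (code : seq node) (B : nat).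
Hypotheses (k1 : (1 < k)%N) (code0 : (0 < size code)%N) (sizeB : (size code <= B)%N)
  (boundB : all (node_bound B) code).

(* A configuration [(pc, z, E)] is stored in the block of [pc], all other blocks
   being 0: the coordinate [None] holds [E] and [Some (i, j)] holds [z i * z j]. *)
Definition coords : finType := ('I_3 + 'I_B.+1 * option ('I_B.+1 * 'I_B.+1))%type.
Definition vec : Type := 'I_2 + coords -> int.

Definition cE (p : 'I_B.+1) : 'I_2 + coords := inr (inr (p, None)).
Definition cP (p i j : 'I_B.+1) : 'I_2 + coords := inr (inr (p, Some (i, j))).
(** [cX] carries the term of the sequence, [cN] the number itself and [c1] the constant 1. *)
Definition cX : 'I_2 + coords := inr (inl (inord 0)).
Definition cN : 'I_2 + coords := inr (inl (inord 1)).
Definition c1 : 'I_2 + coords := inr (inl (inord 2)).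

(* Vanishes exactly on accepting configurations, as [z 0 = 1]. *)
Definition value (Y : vec) : int :=
  Y (cE (inord (size code))) +
  \sum_(p : 'I_B.+1 | p != size code :> nat) Y (cP p ord0 ord0).

(** The square [(z r - z s) ^+ 2] expanded into products of registers, which are coordinates. *)
Definition err_form (nd : node) (p : 'I_B.+1) (Y : vec) : int :=
  if nd is NChk r s then
    Y (cP p (inord r) (inord r)) + (- 2 * Y (cP p (inord r) (inord s))
      + Y (cP p (inord s) (inord s)))
  else 0.

(** Brings the input [n] into register 2 at address 1. The square of register 2 needs [n * n] as an
    entry of its own, not being linear in [n]. The [inl] entries vanish after the first digit, so
    nothing is loaded later. *)
Definition load (p i j : nat) (Y : vec) : int :=
  if p == 1 then
    if ((i == 0) && (j == 2)) || ((i == 2) && (j == 0)) then Y (inl ord0)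
    else if (i == 2) && (j == 2) then Y (inl ord_max) else 0
  else 0.

Definition jumps (d : nat) (p q : 'I_B.+1) : bool :=
  next_pc (node_at code p) (d != 0)%N p == q.

(** Coordinate [s] of the vector at [k * m + d], where [Y] is the vector at [m]. Products of updated
    registers are bilinear in the old registers, hence linear in their products. *)
Definition phi (d : nat) (s : 'I_2 + coords) (Y : vec) : int :=
  match s with
  | inl _ => 0
  | inr (inl x) =>
      if x == 0 :> nat then k%:Z * Y cN + (if d == 1%N then 4 * value Y else d%:Z * Y c1)
      else if x == 1 :> nat then k%:Z * Y cN + d%:Z * Y c1 else Y c1
  | inr (inr (q, None)) =>
      \sum_(p | jumps d p q) (Y (cE p) + err_form (node_at code p) p Y)
  | inr (inr (q, Some (i, j))) =>
      \sum_(p | jumps d p q) (\sum_(u < B.+1) \sum_(v < B.+1)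
        coef (node_at code p) i u * (coef (node_at code p) j v * Y (cP p u v)))
      + load q i j Y
  end.

Definition init (t : coords) : int :=
  match t with
  | inl x => (x == 2 :> nat)%:R
  | inr (p, Some (i, j)) => (p == 0 :> nat)%:R * ((i == 0 :> nat)%:R * (j == 0 :> nat)%:R)
  | inr (_, None) => 0
  end.

Lemma linear_value : linear_form value.
Proof.
apply: linear_formD; first exact: linear_form_proj.
by apply: linear_form_sum => p; apply: linear_form_proj.
Qed.

Lemma linear_phi d s : linear_form (phi d s).
Proof.
rewrite /phi; case: s => [x|[x|[q [[i j]|]]]]; first exact: linear_form0.
- have pr c t : linear_form (fun Y : vec => c * Y t) by apply/linear_formZ/linear_form_proj.
  case: (x == 0 :> nat); last first.
    by case: (x == 1 :> nat); [apply: linear_formD | apply: linear_form_proj].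
  apply: linear_formD => //; case: (d == 1%N) => //.
  exact: linear_formZ linear_value.
- apply: linear_formD.
    do 3!apply: linear_form_sum => ?.
    by do 2!apply: linear_formZ; apply: linear_form_proj.
  rewrite /load; case: (q == 1 :> nat); last exact: linear_form0.
  case: (_ || _); first exact: linear_form_proj.
  by case: (_ && _); [exact: linear_form_proj | exact: linear_form0].
apply: linear_form_sum => p; apply: linear_formD; first exact: linear_form_proj.
case: (node_at code p) => *; rewrite /err_form; try exact: linear_form0.
apply: linear_formD; first exact: linear_form_proj.
by apply: linear_formD; first apply: linear_formZ; apply: linear_form_proj.
Qed.

Definition encodes (x : config) (Y : vec) : Prop :=
  let: (pc, z, E) := x in
  [/\ (pc <= B)%N, z 0 = 1,
      forall p, Y (cE p) = if p == pc :> nat then E else 0 &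
      forall p i j, Y (cP p i j) = if p == pc :> nat then z i * z j else 0].

Lemma node_at_bound pc : (pc <= B)%N -> node_bound B (node_at code pc).
Proof.
move=> le; rewrite /node_at; case: (ltnP pc (size code)) => lt.
  exact: (all_nthP _ boundB).
by rewrite nth_default //= le.
Qed.

Lemma next_pc_bound pc d : (pc <= B)%N -> (next_pc (node_at code pc) d pc <= B)%N.
Proof.
move=> le; have := node_at_bound le; rewrite /node_at.
case: (ltnP pc (size code)) => lt; last by rewrite nth_default //=; case: d.
case: (nth _ _ _) => [r s c|r s|q0 q1] /= /andP [l1 l2]; try exact: leq_trans lt sizeB.
by case: d.
Qed.

Lemma value_encodes x Y : encodes x Y -> value Y = 0 <-> accept code x.
Proof.
case: x => [[pc z] E] [le z0 HE HP]; rewrite /value /accept /= HE inordK //.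
rewrite (sum_block _ le (x := z 0%N * z 0%N)) => [|p]; last by rewrite HP.
rewrite inordK // z0 eq_sym; case: eqP => /= [->|ne].
  by rewrite addr0; split=> [->|[]].
by split=> [|[]].
Qed.

(** [load] stays in the conclusion to cover the first digit, where the [inl] entries may be
    nonzero. *)
Lemma phi_encodes d x Y : encodes x Y ->
  let: (pc, z, E) := step code x (d != 0)%N in
  [/\ (pc <= B)%N, z 0 = 1,
      forall p, phi d (cE p) Y = if p == pc :> nat then E else 0 &
      forall p i j, phi d (cP p i j) Y =
        (if p == pc :> nat then z i * z j else 0) + load p i j Y].
Proof.
case: x => [[pc z] E] [le z0 HE HP] /=.
have nb := node_at_bound le; set nd := node_at code pc in nb *.
split; first exact: next_pc_bound.
- by case: (nd).
- move=> q; rewrite (sum_block _ le (x := E + node_err nd z)).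
    by rewrite /jumps inordK // -/nd eq_sym.
  move=> p; rewrite HE; case: eqP => [e|ne].
    rewrite e -/nd; congr (_ + _); case: (nd) nb => // r s /= /andP [l1 l2].
    by rewrite !HP e eqxx !inordK //; ring.
  case: (node_at code p) => //= *; rewrite ?add0r //.
  by rewrite !HP; case: eqP => // _; rewrite mulr0.
move=> q i j; congr (_ + _).
rewrite (sum_block _ le (x := next_state nd z i * next_state nd z j)).
  by rewrite /jumps inordK // -/nd eq_sym.
move=> p; case: eqP => [e|ne]; last first.
  rewrite big1 // => u _; rewrite big1 // => v _; rewrite HP.
  by case: eqP => // _; rewrite !mulr0.
have sc (i' : 'I_B.+1) := sum_coef z nb (ltn_ord i' : (i' <= B)%N).
rewrite e -/nd -(sc i) -(sc j) mulr_suml; apply: eq_bigr => u _.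
rewrite mulr_sumr; apply: eq_bigr => v _; rewrite HP e eqxx.
ring.
Qed.

Lemma phi_encodes_step d x Y : (forall i, Y (inl i) = 0) -> encodes x Y ->
  encodes (step code x (d != 0)%N) (phi d ^~ Y).
Proof.
move=> Y0 /(phi_encodes d); case: (step _ _ _) => [[pc z] E] [le z0 HE HP].
split=> // p i j; rewrite HP /load !Y0.
by do !case: ifP => _; rewrite ?addr0.
Qed.

Definition start_state (n : nat) : state := upd (upd (fun=> 0) 0 1) 2 n.

Hypothesis code_start : node_at code 0 = NFork 1 1.

Section Sequence.
Variables (n : nat) (F : nat -> vec).
Hypotheses (F00 : forall i : 'I_2, F 0%N (inl i) = nth 0 [:: n%:Z; (n * n)%N%:Z] i)
  (F01 : forall t, F 0%N (inr t) = init t)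
  (FS : forall m s, (0 < m)%N -> F m s = phi (m %% k)%N s (F (m %/ k)%N)).

Lemma F_slots m i : (0 < m)%N -> F m (inl i) = 0.
Proof. by move=> m0; rewrite FS. Qed.

Lemma F_one m : F m c1 = 1.
Proof.
elim/ltn_ind: m => -[|m] IH; first by rewrite F01 /= inordK.
by rewrite FS //= inordK // IH // ltn_Pdiv.
Qed.

Lemma F_num m : F m cN = m%:Z.
Proof.
elim/ltn_ind: m => -[|m] IH; first by rewrite F01 /= inordK.
rewrite FS //= inordK //= IH ?ltn_Pdiv // F_one mulr1 -PoszM -PoszD.
by rewrite mulnC -divn_eq.
Qed.

Lemma F_out m : F m cX =
  if (m %% k == 1)%N then (k * (m %/ k))%N%:Z + 4 * value (F (m %/ k)%N) else m%:Z.
Proof.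
case: m => [|m]; first by rewrite F01 /= inordK // mod0n.
rewrite FS //= inordK //= F_num F_one; case: ifP => _; first by rewrite PoszM.
by rewrite mulr1 -PoszM -PoszD mulnC -divn_eq.
Qed.

Lemma encodes0 : encodes (0%N, upd (fun=> 0) 0%N 1, 0) (F 0).
Proof.
split=> // [p|p i j]; rewrite F01 /=; first by case: ifP.
by rewrite /upd; do !case: eqP => _; rewrite ?(mul0r, mulr0, mul1r).
Qed.

(** Before the leading digit only register 0 is nonzero; [load] adds exactly the products that
    involve register 2. *)
Lemma encodes_lead d : (0 < d < k)%N -> encodes (1%N, start_state n, 0) (F d).
Proof.
case/andP=> d0 dk; have := phi_encodes d encodes0.
rewrite code_start (_ : next_pc _ _ _ = 1%N) /next_state /node_err ?addr0;
  last by case: d {dk} d0.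
case=> le z0 HE HP.
have FE s : F d s = phi d s (F 0) by rewrite FS // modn_small // divn_small.
split=> // [p|p i j]; first by rewrite FE HE.
rewrite FE HP /load !F00 /= /start_state /upd; case: eqP => _; last by rewrite addr0.
by case: (nat_of_ord i) => [|[|[|?]]]; case: (nat_of_ord j) => [|[|[|?]]];
  rewrite /= ?(mul0r, mulr0, mul1r, mulr1, addr0, add0r) ?PoszM.
Qed.

Lemma F_encodes_run m : (0 < m)%N ->
  exists ds, encodes (run code (1%N, start_state n, 0) ds) (F m).
Proof.
elim/ltn_ind: m => m IH m0.
have [q0|q0] := posnP (m %/ k).
  by exists [::]; apply: encodes_lead; rewrite m0 ltnNge -divn_gt0 ?q0 // ltnW.
have [ds H] := IH _ (ltn_Pdiv k1 m0) q0.
exists (rcons ds (m %% k != 0)%N); rewrite /run foldl_rcons.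
have := phi_encodes_step (m %% k)%N (fun i => F_slots i q0) H.
rewrite -/(run code _ ds); case: (step _ _ _) => [[pc z] E] [le z0 HE HP].
by split=> // [p|p i j]; rewrite FS // ?HE ?HP.
Qed.

(** The number has leading digit 1, followed by the choices as digits 0 and 1. *)
Lemma F_run_encodes ds :
  exists2 m, (0 < m)%N & encodes (run code (1%N, start_state n, 0) ds) (F m).
Proof.
elim/last_ind: ds => [|ds d [m m0 H]]; first by exists 1%N => //; apply: encodes_lead.
have dk : (d < k)%N by apply: leq_trans k1; case: d.
have e1 : ((m * k + d) %% k = d)%N by rewrite modnMDl modn_small.
have e2 : ((m * k + d) %/ k = m)%N by rewrite divnMDl ?divn_small ?addn0 // ltnW.
have M0 : (0 < m * k + d)%N by rewrite addn_gt0 muln_gt0 m0 ltnW.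
exists (m * k + d)%N => //; rewrite /run foldl_rcons.
have := phi_encodes_step d (fun i => F_slots i m0) H.
rewrite -/(run code _ ds) eqb0 negbK; case: (step _ _ _) => [[pc z] E] [le z0 HE HP].
by split=> // [p|p i j]; rewrite FS // e1 e2 ?HE ?HP.
Qed.

Lemma value_zero_iff :
  (exists m, value (F m) = 0) <->
  exists ds, accept code (run code (1%N, start_state n, 0) ds).
Proof.
split=> [[[|m]]|[ds A]].
(* At 0 the machine is at address 0, which is not the end of the nonempty code. *)
- by move/(value_encodes encodes0) => [/= e _]; move: code0; rewrite -e.
- by move=> e; have [ds H] := F_encodes_run (ltn0Sn m); exists ds; apply/(value_encodes H).
by have [m _ H] := F_run_encodes ds; exists m; apply/(value_encodes H).
Qed.

End Sequence.
End Encoding.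

(** * Diagonalization *)

Lemma palindrome_family k (q : prf) : (1 < k)%N ->
  exists r (v : 'rV[int]_r.+2) (w : 'cV[int]_r.+2) (M : k.-tuple 'M[int]_r.+2), forall n : nat,
  has_nontrivial_palindrome (kreg_seq (existT _ r.+2
    (v, \col_(i < r.+2) nth (w i ord0) [:: n%:Z; (n * n)%N%:Z] i, M) : linrep k)) <->
  exists y, eval q [:: n] y.
Proof.
move=> k1; pose code := prog_code (compile q [:: 2] 2).
have [B [sB bB]] := node_bound_ex code.
(* The argument [inl (inord 0)] selects the coordinate [cX], where the term is read off. *)
have [v [w [M H]]] := linrep_of_forms (@init B) (inl (inord 0)) k1 (@linear_phi k code B).
exists #|coords B|, v, w, M => n.
have [F [F00 F01 FS Fout]] := H n%:Z (n * n)%N%:Z.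
rewrite (palindrome_iff (h := fun m => value code (F m)) k1) => [|m]; last first.
  by rewrite Fout; apply: (F_out _ F01 FS).
rewrite (value_zero_iff k1 _ sB bB _ F00 F01 FS) //.
exact: (halting_code q (z := start_state)).
Qed.

Local Close Scope ring_scope.

Theorem theorem5p2 (k : nat) (hk : 2 <= k) :
  ~ decidable_set (palindrome_problem k).
Proof.
(* On input [c], [q] searches for a zero of a function constant in the search variable, the verdict
   of [p] on the output of [prf_diag]: it stops at once on 0 and never on 1. *)
case=> p Hp; pose q := PMu (PComp p [:: PComp prf_diag [:: PProj 1]]).
have [r [v [w [M H]]]] := palindrome_family q hk.
pose L a b : linrep k :=
  existT _ r.+2 (v, \col_(i < r.+2) nth (w i ord0) [:: Posz a; Posz b] i, M)%R.
(* Any member of the family of [q] would do for [c]; [d] codes the member with parameter [c], whose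
   palindromes tell whether [q] halts on [c]. *)
pose c := pickle (L 0 0); pose d := pickle (L c (c * c)).
have Hd : eval prf_diag [:: c] d := eval_diag v w M 0 0.
have HA : palindrome_problem k d <-> exists y, eval q [:: c] y.
  rewrite -H; split=> [[L' [/(pcan_inj pickleK) -> //]]|pal].
  by exists (L c (c * c)).
clearbody c d => {H}.
have Hg y : eval (PComp prf_diag [:: PProj 1]) [:: y; c] d.
  exact: eval_comp1 (ev_proj 1 [:: y; c]) Hd.
have [Hp1 Hp0] := Hp d.
have nA : ~ palindrome_problem k d.
  (* If [q] halts on [c], then [p] returns 0 on [d], whereas a positive instance makes it return
     1. *)
  move=> A; have [y ey] := HA.1 A.
  inversion ey as [| | | | | |? ? ? e0 _]; subst.
  by have := eval_det e0 (eval_comp1 (Hg y) (Hp1 A)).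
(* Now [p] rejects [d], so [q] halts on [c] at search value 0, and a palindrome exists after all. *)
apply/nA/HA; exists 0; apply: ev_mu => //.
exact: eval_comp1 (Hg 0) (Hp0 nA).
Qed.
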